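(* Let $f:\mathbb{R}\to\mathbb{R}$ be a bounded, locally integrable function with a (non-removable) jump discontinuity at $t\in\mathbb{R}$, and let $\alpha\in\mathbb{R}$. Let $\chi:\mathbb{R}\to\mathbb{R}$ be a kernel such that $\chi(x)=0$ for every $x\in[0,1)$. Then the following assertions are equivalent: (i) $\displaystyle\lim_{w\to+\infty}(S_wf)(t)=\alpha\,f(t+0)+(1-\alpha)\,f(t-0)$; (ii) $\Psi^-_\chi(x)=\alpha$ for every $x\in[0,1)$; (iii) $\Psi^+_\chi(x)=1-\alpha$ for every $x\in[0,1)$. If in addition $\chi$ is continuous on $\mathbb{R}$, then (i), (ii) and (iii) are also equivalent to each of the following: (iv) $\displaystyle\int_{-\infty}^0\chi(u)\,e^{-iu2\pi k}\,du=\begin{cases}\alpha, & k=0,\\ 0, & k\in\mathbb{Z}\setminus\{0\};\end{cases}$ (v) $\displaystyle\int_0^{+\infty}\chi(u)\,e^{-iu2\pi k}\,du=\begin{cases}1-\alpha, & k=0,\\ 0, & k\in\mathbb{Z}\setminus\{0\}.\end{cases}$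
   Context: A function $\chi:\mathbb{R}\to\mathbb{R}$ is called a kernel if: (1) $\chi\in L^1(\mathbb{R})$ and $\chi$ is bounded on $[-1,1]$; (2) $\sum_{k\in\mathbb{Z}}\chi(u-k)=1$ for every $u\in\mathbb{R}$; (3) for some $\beta>0$, $m_\beta(\chi):=\sup_{u\in\mathbb{R}}\sum_{k\in\mathbb{Z}}|\chi(u-k)|\,|u-k|^\beta<+\infty$. For a kernel $\chi$ and $w>0$, the sampling Kantorovich operator is $(S_wf)(t):=\sum_{k\in\mathbb{Z}}\chi(wt-k)\left[w\int_{k/w}^{(k+1)/w}f(u)\,du\right]$, $t\in\mathbb{R}$, for locally integrable $f:\mathbb{R}\to\mathbb{R}$ such that the series converges for each $t\in\mathbb{R}$ (this holds for bounded measurable $f$). Notation: $f(t\pm0):=\lim_{\varepsilon\to0^+}f(t\pm\varepsilon)$; a (non-removable) jump discontinuity at $t$ means that both limits $f(t+0)$, $f(t-0)$ exist and are finite and $f(t+0)\neq f(t-0)$. For $x\in\mathbb{R}$, $\Psi^+_\chi(x):=\sum_{k\in\mathbb{Z},\,k<x}\chi(x-k)$ and $\Psi^-_\chi(x):=\sum_{k\in\mathbb{Z},\,k>x}\chi(x-k)$.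
   Formalization: The implication from (i) to (ii), and hence to (iii), (iv), (v), is stated only for t ≠ 0; at t = 0 it is false, since (S_w f)(0) depends only on the values of χ at integers. All other implications are kept for every t. *)

(* Defs.v *)
From HB Require Import structures.
From mathcomp Require Import all_boot all_order all_algebra.
From mathcomp Require Import all_classical all_reals all_analysis.
From mathcomp Require Import complex.

Set Implicit Arguments.
Unset Strict Implicit.
Unset Printing Implicit Defensive.

Import Order.TTheory GRing.Theory Num.Theory.
Import numFieldNormedType.Exports.

Local Open Scope classical_set_scope.
Local Open Scope ring_scope.
Local Open Scope complex_scope.

(* \sum_(-m <= k < n) a k, with p = (m, n); Negz j denotes - (j + 1). *)
Definition zpartial (R : realType) (a : int -> R) (p : nat * nat) : R :=
  \sum_(j < p.1) a (Negz j) + \sum_(j < p.2) a (Posz j).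

(* The two bounds go to infinity independently, so both one-sided series have
   to converge. *)
Definition zsum_to (R : realType) (a : int -> R) (l : R) : Prop :=
  zpartial a p @[p --> filter_prod \oo \oo] --> l.

(* Meaningful only when the two-sided series converges. *)
Definition zsum (R : realType) (a : int -> R) : R :=
  lim (zpartial a p @[p --> filter_prod \oo \oo]).

Definition abs_moment (R : realType) (beta : R) (chi : R -> R) : \bar R :=
  ereal_sup [set (\esum_(k in [set: int])
                    (`|chi (u - k%:~R)| * `|u - k%:~R| `^ beta)%:E)%E
            | u in [set: R]].

Definition is_kernel (R : realType) (chi : R -> R) : Prop :=
  [/\ (@lebesgue_measure R).-integrable setT (EFin \o chi)
        /\ [bounded chi x | x in `[-1, 1]],
      forall u : R, zsum_to (fun k => chi (u - k%:~R)) 1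
    & exists2 beta : R, 0 < beta & (abs_moment beta chi < +oo)%E].

(* At t = 0 only the values of chi at integers occur, so the limit of
   kantorovich chi w f 0 as w --> +oo constrains Psi_minus chi below at x = 0
   only. *)
Definition kantorovich (R : realType) (chi : R -> R) (w : R) (f : R -> R)
    (t : R) : R :=
  zsum (fun k : int => chi (w * t - k%:~R) *
    (w * \int[@lebesgue_measure R]_(u in `[k%:~R / w, (k%:~R + 1) / w]) f u)).

Definition right_lim (R : realType) (f : R -> R) (t : R) : R :=
  lim (f x @[x --> t^'+]).

Definition left_lim (R : realType) (f : R -> R) (t : R) : R :=
  lim (f x @[x --> t^'-]).

Definition jump_discontinuity (R : realType) (f : R -> R) (t : R) : Prop :=
  [/\ cvg (f x @[x --> t^'+]), cvg (f x @[x --> t^'-])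
    & right_lim f t <> left_lim f t].

Definition Psi_plus (R : realType) (chi : R -> R) (x : R) : R :=
  zsum (fun k : int => if k%:~R < x then chi (x - k%:~R) else 0).

Definition Psi_minus (R : realType) (chi : R -> R) (x : R) : R :=
  zsum (fun k : int => if x < k%:~R then chi (x - k%:~R) else 0).

Definition expi (R : realType) (theta : R) : R[i] := cos theta +i* sin theta.

(* Lebesgue integral of a complex-valued function, componentwise. *)
Definition Cintegral (R : realType) (D : set R) (g : R -> R[i]) : R[i] :=
  (\int[@lebesgue_measure R]_(u in D) complex.Re (g u))
  +i* (\int[@lebesgue_measure R]_(u in D) complex.Im (g u)).

(* The integral over D of chi(u) e^(-i u 2 pi k). *)
Definition fourier_on (R : realType) (D : set R) (chi : R -> R) (k : int) :
    R[i] :=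
  Cintegral D (fun u => (chi u)%:C * expi (- (u * (2 * pi * k%:~R)))).

(* Main.v *)
(** If [k <= w t < k + 1] then [chi (w t - k) = 0], so only averages of [f] over
    intervals lying on one side of [t] contribute to [S_w f (t)], and the moment
    condition makes the contribution of the distant intervals uniformly small.
    Hence [S_w f (t) = f(t+0) Psi^-(w t) + f(t-0) Psi^+(w t) + o(1)], where
    [Psi^-] and [Psi^+] are 1-periodic with sum 1; for [t <> 0], [w t] meets
    every residue class modulo 1 for arbitrarily large [w].

    For continuous [chi], folding a half-line onto [[0, 1]] identifies the
    half-line Fourier integrals at integer frequencies with the Fourier
    coefficients of the continuous function [Psi^-] (resp. [Psi^+]) on [[0, 1]],
    and a continuous function is determined on [(0, 1)] by these coefficients. *)

Require Import Defs.
From HB Require Import structures.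
From mathcomp Require Import all_boot all_order all_algebra.
From mathcomp Require Import all_classical all_reals all_analysis.
From mathcomp Require Import measurable_realfun complex.
From mathcomp Require Import zify ring lra.

Set Implicit Arguments.
Unset Strict Implicit.
Unset Printing Implicit Defensive.

Import Order.TTheory GRing.Theory Num.Theory.
Import numFieldNormedType.Exports.

Local Open Scope classical_set_scope.
Local Open Scope ring_scope.
Local Open Scope complex_scope.

(** * Two-sided series *)

Section TwoSidedSums.
Context {R : realType}.
Implicit Types (a b : int -> R) (M l : R).

Lemma zpartialD a b p :
  zpartial (fun k => a k + b k) p = zpartial a p + zpartial b p.
Proof. by rewrite /zpartial !big_split addrACA. Qed.

Lemma zpartialZ c a p : zpartial (fun k => c * a k) p = c * zpartial a p.
Proof. by rewrite /zpartial -!mulr_sumr mulrDr. Qed.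

Lemma ler_zpartial a b p :
  (forall k, a k <= b k) -> zpartial a p <= zpartial b p.
Proof. by move=> ab; rewrite lerD// ler_sum. Qed.

Lemma zpartial_shift a m n :
  zpartial (fun k => a (k + 1)) (m.+1, n) = zpartial a (m, n.+1).
Proof.
rewrite /zpartial/= big_ord_recl big_ord_recl/= -!addrA.
rewrite [RHS]addrCA; congr (_ + (_ + _)).
- by apply: eq_bigr => i _; congr (a _); rewrite !NegzE /bump; lia.
- by apply: eq_bigr => i _; congr (a _); rewrite /bump; lia.
Qed.

Lemma zsum_toP a l : zsum_to a l <-> forall e, 0 < e ->
  exists N, forall m n, (N <= m)%N -> (N <= n)%N ->
    `|l - zpartial a (m, n)| <= e.
Proof.
split.
  move=> /cvgrPdist_le + e e0 => /(_ e e0)[[A B] [[N1 _ hA] [N2 _ hB]] AB].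
  exists (maxn N1 N2) => m n Nm Nn; apply: (AB (m, n)); split.
    by apply: hA; rewrite /= (leq_trans _ Nm)// leq_maxl.
  by apply: hB; rewrite /= (leq_trans _ Nn)// leq_maxr.
move=> h; apply/cvgrPdist_le => e /h[N hN].
exists ([set n | (N <= n)%N], [set n | (N <= n)%N]); last first.
  by move=> [m n]/= [Nm Nn]; exact: hN.
by split; exists N.
Qed.

Lemma zsum_to_zsum a l : zsum_to a l -> zsum a = l.
Proof. exact: cvg_lim. Qed.

Lemma zsum_toD a b l l' : zsum_to a l -> zsum_to b l' ->
  zsum_to (fun k => a k + b k) (l + l').
Proof.
move=> al bl; rewrite /zsum_to; under eq_cvg do rewrite zpartialD.
exact: cvgD.
Qed.

Lemma zsum_toZ c a l : zsum_to a l -> zsum_to (fun k => c * a k) (c * l).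
Proof.
move=> al; rewrite /zsum_to; under eq_cvg do rewrite zpartialZ.
by apply: cvgM => //; exact: cvg_cst.
Qed.

Lemma zsum_to_shift a l : zsum_to a l -> zsum_to (fun k => a (k + 1)) l.
Proof.
move=> /zsum_toP h; apply/zsum_toP => e /h[N hN]; exists N.+1 => -[//|m] n.
rewrite ltnS => Nm Nn; rewrite zpartial_shift; apply: hN => //.
by rewrite (leq_trans _ (leqnSn _))// (leq_trans _ Nn).
Qed.

(** Absolute summability with an explicit constant. The same [M] bounds the sum ([zbounded_norm]),
    so estimates on two-sided series reduce to estimates on partial sums. *)
Definition zbounded a M := forall p, zpartial (fun k => `|a k|) p <= M.

Lemma zbounded_half (u : nat -> R) M :
  (forall n, \sum_(j < n) `|u j| <= M) -> cvgn (series u).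
Proof.
move=> uM; apply: normed_cvg; apply: nondecreasing_is_cvgn.
  by apply: nondecreasing_series => n _ _; exact: normr_ge0.
exists M => _ [n _ <-]; have := uM n.
by rewrite -(big_mkord predT (fun j => `|u j|)).
Qed.

(** Each half is bounded by leaving the range of the other empty, so both converge absolutely; the
    two projections of the product filter combine their limits. *)
Lemma zbounded_cvg a M : zbounded a M -> zsum_to a (zsum a).
Proof.
move=> aM.
have cN : cvgn (series (fun j => a (Negz j))).
  apply: (@zbounded_half _ M) => n; apply: le_trans (aM (n, 0%N)).
  by rewrite /zpartial/= big_ord0 addr0.
have cP : cvgn (series (fun j => a (Posz j))).
  apply: (@zbounded_half _ M) => n; apply: le_trans (aM (0%N, n)).
  by rewrite /zpartial/= big_ord0 add0r.
suff : zsum_to a (limn (series (fun j => a (Negz j))) +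
                  limn (series (fun j => a (Posz j)))).
  by move=> h; rewrite (zsum_to_zsum h).
rewrite /zsum_to /zpartial.
under eq_cvg => p do rewrite -(big_mkord predT (fun j => a (Negz j)))
  -(big_mkord predT (fun j => a (Posz j))).
apply: cvgD.
- by apply: (cvg_comp fst _ _ cN); exact: cvg_fst.
- by apply: (cvg_comp snd _ _ cP); exact: cvg_snd.
Qed.

Lemma zbounded_norm a M : zbounded a M -> `|zsum a| <= M.
Proof.
move=> aM; apply/ler_addgt0Pr => e e0.
have /zsum_toP/(_ e e0)[N /(_ N N (leqnn _) (leqnn _)) h] := zbounded_cvg aM.
rewrite -[zsum a](subrK (zpartial a (N, N))) (le_trans (ler_normD _ _))//.
rewrite addrC lerD// (le_trans _ (aM (N, N)))// /zpartial.
by rewrite (le_trans (ler_normD _ _))// lerD// ler_norm_sum.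
Qed.

Lemma zpartial_delta (c : int) p : zpartial (fun k => (k == c)%:R : R) p <= 1.
Proof.
case: p => m n; have half (f : nat -> int) N : injective f ->
    \sum_(j < N) (f j == c)%:R <= 1 :> R.
  move=> fI; rewrite -natr_sum -[leRHS]/(1%:R) ler_nat.
  rewrite (eq_bigr (fun j : 'I_N => if f j == c then 1%N else 0%N)) //.
  rewrite -big_mkcond sum1dep_card; apply/card_le1_eqP => i j.
  rewrite !inE => /eqP <- /eqP /fI ij; exact/val_inj.
case: c half => c half; rewrite /zpartial/=.
  by rewrite big1 ?add0r ?half// => [i j []].
by rewrite addrC big1 ?add0r ?half// => [i j []].
Qed.

End TwoSidedSums.

(** * Uniform bounds on the sums of a kernel *)

Section KernelBounds.
Context {R : realType}.
Implicit Types (chi : R -> R) (a : int -> R).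

Lemma zpartial_esum a p : (forall k, 0 <= a k) ->
  ((zpartial a p)%:E <= \esum_(k in [set: int]) (a k)%:E)%E.
Proof.
move=> a0; apply: esum_ge; case: p => m n.
pose s := [seq Negz j | j <- index_iota 0 m] ++
          [seq Posz j | j <- index_iota 0 n].
exists [set` s]; first by split => //; exact: finite_seq.
have us : uniq s.
  rewrite cat_uniq !map_inj_uniq ?iota_uniq ?andbT => [|i j []|i j []]//=.
  by apply/hasPn => _ /mapP[j _ ->]; apply/mapP => -[].
rewrite -(fsbig_seq _ _ us) sumEFin lee_fin big_cat/= !big_map.
by rewrite !big_mkord.
Qed.

(** Where |u - k| >= 1 the factor |u - k|^beta is at least 1, so the moment dominates. The remaining
    indices are among [floor u] and [floor u + 1], and there the bound [B] of [chi] on [-1, 1]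
    applies; hence the constant [M + B * 2]. *)
Lemma kernel_bounds chi : is_kernel chi -> exists beta M, [/\ 0 < beta, 0 <= M,
  forall u p, zpartial (fun k => `|chi (u - k%:~R)|) p <= M &
  forall u p, zpartial (fun k =>
    `|chi (u - k%:~R)| * `|u - k%:~R| `^ beta) p <= M].
Proof.
move=> [[_ /pinfty_ex_gt0[B B0 chiB]] _ [beta beta0 mfin]].
pose a u (k : int) := `|chi (u - k%:~R)| * `|u - k%:~R| `^ beta.
have a0 u k : 0 <= a u k by rewrite mulr_ge0 ?powR_ge0.
pose M := fine (abs_moment beta chi).
have leM u p : zpartial (a u) p <= M.
  have : ((zpartial (a u) p)%:E <= abs_moment beta chi)%E.
    rewrite (le_trans (zpartial_esum _ (a0 u)))//.
    by apply: ereal_sup_ubound; exists u.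
  rewrite /M; case: abs_moment mfin => //= r _; by rewrite lee_fin.
have M0 : 0 <= M.
  by rewrite -(_ : zpartial (a 0) (0%N, 0%N) = 0) ?leM// /zpartial !big_ord0 addr0.
exists beta, (M + B * 2); split => //; last 2 first.
- move=> u p; pose c := Num.floor u.
  apply: (@le_trans _ _ (zpartial (fun k =>
      a u k + B * ((k == c)%:R + (k == c + 1)%:R)) p)); last first.
    rewrite zpartialD lerD//.
    rewrite (zpartialZ B (fun k => (k == c)%:R + (k == c + 1)%:R)).
    rewrite ler_pM2l// zpartialD (_ : 2 = 1 + 1)//.
    by rewrite lerD// zpartial_delta.
  apply: ler_zpartial => k.
  have [ge1|lt1] := leP 1 `|u - k%:~R|.
    rewrite (@le_trans _ _ (a u k))//; last first.
      by rewrite lerDl mulr_ge0 ?addr_ge0// ltW.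
    rewrite /a ler_peMr//.
    by have := ler_powR ge1 (ltW beta0); rewrite powRr0.
  rewrite (@le_trans _ _ B)//.
    by apply: chiB; rewrite /= in_itv/= -ler_norml ltW.
  rewrite ler_wpDl// -[leLHS]mulr1 ler_pM2l//.
  have [ku|uk] := leP k%:~R u.
    rewrite /c (@floor_def _ _ k) ?eqxx ?lerDl//.
    rewrite ku/= intrD; move: lt1; rewrite ltr_norml; lra.
  rewrite /c (@floor_def _ _ (k - 1)) ?subrK ?eqxx ?lerDr//.
  move: lt1; rewrite uk andbT intrB ltr_norml; lra.
- by move=> u p; rewrite (le_trans (leM u p))// lerDl mulr_ge0// ltW.
by rewrite addr_ge0// mulr_ge0// ltW.
Qed.

End KernelBounds.

(** * Convergence, sum and periodicity of Psi^- and Psi^+ *)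

Section Psi.
Context {R : realType} (chi : R -> R).
Hypothesis chi_kernel : is_kernel chi.

Let minus_term (x : R) (k : int) := if x < k%:~R then chi (x - k%:~R) else 0.
Let plus_term (x : R) (k : int) := if k%:~R < x then chi (x - k%:~R) else 0.

Lemma Psi_minus_to (x : R) : zsum_to (minus_term x) (Psi_minus chi x).
Proof.
have [beta [M [_ _ chiM _]]] := kernel_bounds chi_kernel.
apply: (@zbounded_cvg _ _ M) => p; apply: le_trans (chiM x p).
by apply: ler_zpartial => k; rewrite /minus_term; case: ifP; rewrite ?normr0.
Qed.

Lemma Psi_plus_to (x : R) : zsum_to (plus_term x) (Psi_plus chi x).
Proof.
have [beta [M [_ _ chiM _]]] := kernel_bounds chi_kernel.
apply: (@zbounded_cvg _ _ M) => p; apply: le_trans (chiM x p).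
by apply: ler_zpartial => k; rewrite /plus_term; case: ifP; rewrite ?normr0.
Qed.

(** An index equal to [x] is counted by neither function; its term in the full sum is [chi 0]. *)
Lemma Psi_minusD_plus (x : R) : chi 0 = 0 -> Psi_minus chi x + Psi_plus chi x = 1.
Proof.
move=> chi0; have [_ chi1 _] := chi_kernel.
rewrite -(zsum_to_zsum (zsum_toD (@Psi_minus_to x) (@Psi_plus_to x))).
rewrite -[RHS](zsum_to_zsum (chi1 x)); congr zsum; apply/funext => k.
rewrite /minus_term /plus_term.
have [xk|kx|->] := ltgtP x k%:~R; rewrite ?addr0 ?add0r//.
by rewrite subrr chi0.
Qed.

Lemma Psi_minusD1 (x : R) : Psi_minus chi (x + 1) = Psi_minus chi x.
Proof.
rewrite -(zsum_to_zsum (zsum_to_shift (@Psi_minus_to (x + 1)))).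
congr zsum; apply/funext => k.
by rewrite /minus_term intrD ltrD2r opprD addrACA subrr addr0.
Qed.

Lemma Psi_minusDn (x : R) (n : nat) : Psi_minus chi (x + n%:R) = Psi_minus chi x.
Proof.
elim: n => [|n IH]; first by rewrite addr0.
by rewrite -addn1 natrD addrA Psi_minusD1.
Qed.

Lemma Psi_minusDz (x : R) (m : int) :
  Psi_minus chi (x + m%:~R) = Psi_minus chi x.
Proof.
case: m => n; first exact: Psi_minusDn.
by rewrite NegzE -(Psi_minusDn _ n.+1) -addrA mulrNz addNr addr0.
Qed.

End Psi.

(** * Integrals and averages over bounded intervals *)

Section Averages.
Context {R : realType}.
Implicit Types f : R -> R.
Local Notation mu := (@lebesgue_measure R).

Lemma continuous_itv_integrable f (a b : R) : continuous f ->
  mu.-integrable `[a, b] (EFin \o f).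
Proof.
move=> cf; apply: continuous_compact_integrable; first exact: segment_compact.
exact: continuous_subspaceT.
Qed.

Lemma locally_integrable_itv f (a b : R) : locally_integrable [set: R] f ->
  mu.-integrable `[a, b] (EFin \o f).
Proof.
move=> [mf _ fK]; apply/integrableP; split.
  by apply/measurable_EFinP; exact: measurable_funTS.
by apply: fK => //; exact: segment_compact.
Qed.

(** Closeness is required on the open interval only, the end points being null: [t] can be the right
    end point of a sampling interval, and [f t] is unrelated to the one-sided limits. *)
Lemma Rintegral_near_cst f (a b L e : R) : a < b ->
  mu.-integrable `[a, b] (EFin \o f) ->
  (forall x, a < x < b -> `|f x - L| <= e) ->
  `|\int[mu]_(x in `[a, b]) f x - L * (b - a)| <= e * (b - a).
Proof.
move=> ab intf fL.
have sub : (`]a, b[ : set R) `<=` `[a, b] by exact: subset_itv_oo_cc.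
have ic c : mu.-integrable `]a, b[ (EFin \o cst c).
  apply: (@integrableS _ _ _ mu `[a, b]%classic) => //.
  apply: continuous_itv_integrable.
  exact: cst_continuous.
have iof : mu.-integrable `]a, b[ (EFin \o f).
  by apply: (@integrableS _ _ _ mu `[a, b]%classic).
have len c : c * (b - a) = \int[mu]_(x in `]a, b[) c.
  by rewrite Rintegral_cst//= lebesgue_measure_itv/= lte_fin ab.
have -> : \int[mu]_(x in `[a, b]) f x = \int[mu]_(x in `]a, b[) f x.
  by rewrite /Rintegral integral_itv_bndoo//; exact: (measurable_int mu iof).
have id : mu.-integrable `]a, b[ (EFin \o (fun x => f x - L)).
  exact: (integrableB _ iof (ic L)).
rewrite !len -RintegralB//; last exact: ic.
apply: (le_trans (le_normr_Rintegral _ id)) => //.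
apply: le_Rintegral => //; first exact: (integrable_norm id).
exact: ic.
Qed.

End Averages.

(** * Sampling at a jump *)

Section SamplingAtJump.
Context {R : realType} (f : R -> R) (t : R) (chi : R -> R).
Hypotheses (f_bounded : [bounded f x | x in [set: R]])
  (f_loc : locally_integrable [set: R] f)
  (f_right : cvg (f x @[x --> t^'+])) (f_left : cvg (f x @[x --> t^'-]))
  (chi_kernel : is_kernel chi) (chi_zero : forall x : R, 0 <= x < 1 -> chi x = 0).

Let avg (w : R) (k : int) :=
  w * \int[@lebesgue_measure R]_(u in `[k%:~R / w, (k%:~R + 1) / w]) f u.

Lemma average_near (w : R) (k : int) L e : 0 < w ->
  (forall x, k%:~R / w < x < (k%:~R + 1) / w -> `|f x - L| <= e) ->
  `|avg w k - L| <= e.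
Proof.
move=> w0 fL.
have kw : k%:~R / w < (k%:~R + 1) / w by rewrite ltr_pM2r ?invr_gt0// ltrDl.
have := Rintegral_near_cst kw (locally_integrable_itv _ _ f_loc) fL.
rewrite -mulrBl addrAC subrr add0r div1r -(ler_pM2l w0).
rewrite mulrCA divff ?gt_eqF// mulr1; apply: le_trans.
rewrite -{2}(gtr0_norm w0) -normrM mulrBr mulrCA divff ?gt_eqF// mulr1.
exact: lexx.
Qed.

(** The difference is one series with terms chi(x - k)(avg - L), where [x] is [w * t] and L is the
    one-sided limit on the side of the k-th interval. Near terms are small because f is close to L,
    far ones because of the moment; each group sums to at most [e / 2]. *)
Lemma kantorovich_asymptotic e : 0 < e -> \forall w \near +oo,
  `|kantorovich chi w f t - (right_lim f t * Psi_minus chi (w * t) +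
     left_lim f t * Psi_plus chi (w * t))| <= e.
Proof.
move=> e0; have [beta [M [beta0 M0 chiM0 chiM]]] := kernel_bounds chi_kernel.
have [B B0 fB] := pinfty_ex_gt0 f_bounded.
pose fr := right_lim f t; pose fl := left_lim f t.
(* [C] bounds the distance from any average of [f] to either one-sided limit. *)
pose C := B + `|fr| + `|fl|.
have C0 : 0 < C by rewrite /C -addrA ltr_wpDr// addr_ge0.
(* This makes [e' * M <= e / 2]; adding 1 keeps the divisor positive. *)
pose e' := e / 2 / (M + 1).
have M1 : 0 < M + 1 by rewrite ltr_wpDl.
have e'0 : 0 < e' by rewrite !divr_gt0.
have [dr /= dr0 hr] : \forall x \near t^'+, `|fr - f x| <= e'.
  by move/cvgrPdist_le: f_right; apply.
have [dl /= dl0 hl] : \forall x \near t^'-, `|fl - f x| <= e'.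
  by move/cvgrPdist_le: f_left; apply.
pose d := Num.min dr dl.
have d0 : 0 < d by rewrite lt_min dr0.
have ddr : d <= dr by rewrite ge_min lexx.
have ddl : d <= dl by rewrite ge_min lexx orbT.
pose rb := C / e'.
have rb0 : 0 < rb by rewrite divr_gt0.
(* From the radius [r] on, the moment weight absorbs the crude bound: C <= e' |x - k|^beta. *)
pose r := rb `^ beta^-1.
have r0 : 0 < r by rewrite powR_gt0.
have rE : r `^ beta = rb by rewrite /r -powRrM mulVf ?gt_eqF// powRr1// ltW.
near=> w.
have w0 : 0 < w by near: w; exact: nbhs_pinfty_gt.
(* If |x - k| < r, every point of the k-th interval lies within (r + 1) / w of [t], hence within
   [d]; the 1 accounts for the length 1 / w of the interval. *)
have wd : r + 1 < d * w.
  by rewrite -ltr_pdivrMl//; near: w; apply: nbhs_pinfty_gt; rewrite num_real.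
pose x := w * t.
pose S := fun k : int => chi (x - k%:~R) * avg w k.
have SM : zbounded S (B * M).
  move=> p; apply: (@le_trans _ _ (zpartial (fun k => B * `|chi (x - k%:~R)|) p)).
    apply: ler_zpartial => k; rewrite normrM mulrC ler_wpM2r//.
    rewrite -[avg w k]subr0; apply: average_near => // y _.
    by rewrite subr0; exact: fB.
  by rewrite zpartialZ ler_pM2l.
pose tm (k : int) := if x < k%:~R then chi (x - k%:~R) else 0.
pose tp (k : int) := if k%:~R < x then chi (x - k%:~R) else 0.
pose D k := S k + - fr * tm k + - fl * tp k.
have toD : zsum_to D (kantorovich chi w f t + - fr * Psi_minus chi x +
                      - fl * Psi_plus chi x).
  apply: zsum_toD; last by apply: zsum_toZ; exact: Psi_plus_to.
  apply: zsum_toD; last by apply: zsum_toZ; exact: Psi_minus_to.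
  exact: zbounded_cvg SM.
rewrite opprD !addrA -!mulNr -(zsum_to_zsum toD); apply: zbounded_norm => p.
apply: (@le_trans _ _ (zpartial (fun k => e' * `|chi (x - k%:~R)| +
    e' * (`|chi (x - k%:~R)| * `|x - k%:~R| `^ beta)) p)); last first.
  have e'M z : z <= M -> e' * z <= e / 2.
    move=> zM; rewrite (le_trans (ler_wpM2l (ltW e'0) zM))//.
    by rewrite /e' mulrAC ler_pdivrMr// ler_pM2l ?divr_gt0// lerDl.
  by rewrite zpartialD !zpartialZ (splitr e) lerD// e'M.
apply: ler_zpartial => k.
(* The averages over an interval adjacent to [t] are close to the one-sided
   limit; the others are weighted by the moment condition. *)
have key L : `|L| <= C - B -> (`|x - k%:~R| < r ->
     forall y, k%:~R / w < y < (k%:~R + 1) / w -> `|f y - L| <= e') ->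
   `|chi (x - k%:~R) * (avg w k - L)| <= e' * `|chi (x - k%:~R)| +
    e' * (`|chi (x - k%:~R)| * `|x - k%:~R| `^ beta).
  move=> LC near_t; rewrite normrM mulrC.
  have [far|/near_t h] := leP r `|x - k%:~R|; last first.
    apply: ler_wpDr; first by rewrite mulr_ge0 ?(ltW e'0)// mulr_ge0 ?powR_ge0.
    by apply: ler_wpM2r => //; exact: average_near.
  apply: ler_wpDl; first by rewrite mulr_ge0 ?(ltW e'0).
  rewrite mulrCA mulrC; apply: ler_wpM2l => //.
  apply: (@le_trans _ _ C).
    apply: average_near => // y _; rewrite (le_trans (ler_normB _ _))//.
    rewrite -(subrKC B C) lerD//; exact: fB.
  rewrite mulrC -ler_pdivrMr// -/rb -rE.
  by rewrite ge0_ler_powR ?nnegrE ?(ltW r0) ?(ltW beta0).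
have near_t y y1 y2 : y1 < y * w < y2 -> y1 - x < (y - t) * w < y2 - x.
  by rewrite mulrBl [t * w]mulrC -/x !ltrD2r.
rewrite /D /S /tm /tp.
have [xk|kx|xk] := ltgtP x k%:~R.
- rewrite mulr0 addr0 [- fr * _]mulrC -mulrDr.
  apply: key; first by rewrite /C; have := normr_ge0 fl; lra.
  rewrite distrC gtr0_norm ?subr_gt0// => lt_r y.
  rewrite ltr_pdivrMr// ltr_pdivlMr// => /near_t/andP[ky yk].
  have ty : 0 < y - t.
    by rewrite -(pmulr_lgt0 _ w0) (le_lt_trans _ ky)// subr_ge0 ltW.
  rewrite distrC; apply: hr; last by rewrite -subr_gt0.
  rewrite /= distrC gtr0_norm// (lt_le_trans _ ddr)//.
  rewrite -(ltr_pM2r w0) (lt_trans yk)// (lt_trans _ wd)//.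
  by move: lt_r; lra.
(* When [k < x < k + 1] the k-th interval straddles the jump, and [chi] vanishes at x - k. Otherwise
   the interval lies to the left of [t]. *)
- have [kx1|kx1] := leP (k%:~R + 1) x; last first.
    rewrite chi_zero; last by rewrite subr_ge0 ltW//= ltrBlDl.
    by rewrite !(mul0r, mulr0) !addr0 normr0 mul0r mulr0 addr0.
  rewrite mulr0 addr0 [- fl * _]mulrC -mulrDr.
  apply: key; first by rewrite /C; have := normr_ge0 fr; lra.
  rewrite gtr0_norm ?subr_gt0// => lt_r y.
  rewrite ltr_pdivrMr// ltr_pdivlMr// => /near_t/andP[ky yk].
  have ty : y - t < 0.
    by rewrite -(pmulr_llt0 _ w0) (lt_le_trans yk)// subr_le0.
  rewrite distrC; apply: hl; last by rewrite -subr_lt0.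
  rewrite /= distrC ltr0_norm// (lt_le_trans _ ddl)//.
  rewrite -(ltr_pM2r w0) (lt_trans _ wd)// mulNr ltrNl (lt_trans _ ky)//.
  by move: lt_r; lra.
- have chi0 : chi 0 = 0 by rewrite chi_zero// lexx ltr01.
  by rewrite xk subrr chi0 normr0 !(mul0r, mulr0) !addr0 normr0.
Unshelve. all: by end_near.
Qed.

End SamplingAtJump.

(** * Tiling, translation and exhaustion for integrals *)

Section ContinuousIntegrals.
Context {R : realType}.
Implicit Types (F h : R -> R) (a b c : R).
Local Notation mu := (@lebesgue_measure R).

Lemma Rintegral_itvD F a b c : a <= b -> b <= c -> continuous F ->
  \int[mu]_(x in `[a, c]) F x =
  \int[mu]_(x in `[a, b]) F x + \int[mu]_(x in `[b, c]) F x.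
Proof.
move=> ab bc cF.
have iF x y : mu.-integrable `[x, y] (EFin \o F) by exact: continuous_itv_integrable.
rewrite -[X in _ + X]Rintegral_itv_obnd_cbnd.
  by rewrite -(@Rintegral_itvB _ F (BLeft a) (BRight c) b) ?bnd_simp// subrKC.
by apply: (@integrableS _ _ _ mu `[b, c]%classic) => //; exact: subset_itv_oc_cc.
Qed.

Lemma sum_Rintegral_itv F (p : nat -> R) n :
  {homo p : i j / (i <= j)%N >-> i <= j} -> continuous F ->
  \sum_(j < n) \int[mu]_(x in `[p j, p j.+1]) F x =
  \int[mu]_(x in `[p 0%N, p n]) F x.
Proof.
move=> pmono cF; elim: n => [|n IH].
  by rewrite big_ord0 set_itv1 Rintegral_set1.
by rewrite big_ord_recr/= IH -Rintegral_itvD// pmono.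
Qed.

Lemma sum_Rintegral_itvN F (p : nat -> R) n :
  {homo p : i j / (i <= j)%N >-> j <= i} -> continuous F ->
  \sum_(j < n) \int[mu]_(x in `[p j.+1, p j]) F x =
  \int[mu]_(x in `[p n, p 0%N]) F x.
Proof.
move=> pmono cF; elim: n => [|n IH].
  by rewrite big_ord0 set_itv1 Rintegral_set1.
by rewrite big_ord_recr/= IH addrC -Rintegral_itvD// pmono.
Qed.

Lemma Rintegral_itv_shift F a b c : a <= b -> continuous F ->
  \int[mu]_(x in `[a, b]) F (x + c) = \int[mu]_(x in `[a + c, b + c]) F x.
Proof.
move=> ab cF; rewrite /Rintegral.
have d x : is_derive x (1 : R) (fun x => x + c) 1.
  by rewrite -[X in is_derive _ _ _ X]addr0; exact: is_deriveD.
have dE : (fun x : R => x + c)^`()%classic = cst 1.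
  by apply/funext => x; rewrite derive1E derive_val.
rewrite (@integration_by_substitution_increasing _ (fun x => x + c) F)//.
- by apply/congr1/eq_integral => x _; rewrite dE fctE /= mulr1.
- by move=> x y _ _; rewrite ltrD2r.
- by rewrite dE => x _; exact: cst_continuous.
- by rewrite dE; exact: is_cvg_cst.
- by rewrite dE; exact: is_cvg_cst.
- split => [x _| |]; first exact: ex_derive.
  + by apply: cvg_at_right_filter; apply: cvgD => //; exact: cvg_cst.
  + by apply: cvg_at_left_filter; apply: cvgD => //; exact: cvg_cst.
- exact: continuous_subspaceT.
Qed.

(** Dominated convergence for the restrictions of [F] to [A n], with dominating function |F|. It
    recovers a half-line integral from integrals over bounded intervals. *)
Lemma cvg_Rintegral_sets (D : set R) (A : (set R)^nat) F :
  measurable D -> (forall n, measurable (A n)) -> (forall n, A n `<=` D) ->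
  (forall x, D x -> \forall n \near \oo, A n x) ->
  mu.-integrable D (EFin \o F) ->
  \int[mu]_(x in A n) F x @[n --> \oo] --> \int[mu]_(x in D) F x.
Proof.
move=> mD mA AD nearA iF; apply: fine_cvg.
rewrite fineK; last by apply: integrable_fin_num.
under eq_cvg => n.
  rewrite (_ : (\int[mu]_(x in A n) (F x)%:E =
    \int[mu]_(x in D) ((EFin \o F) \_ (A n)) x)%E); last first.
    by rewrite -integral_mkcondr setIidr.
  over.
apply: (@dominated_cvg _ _ _ mu D mD _ _ (fun x => `|F x|%:E)) => //.
- move=> n; apply/(measurable_restrict _ (mA n) mD).
  rewrite setIidr//; apply: (measurable_int mu).
  apply: (@integrableS _ _ _ mu D) => //; exact: mA.
- move=> x Dx; apply: cvg_near_cst; apply: filterS (nearA x Dx) => n Anx.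
  by rewrite patchE mem_set.
- exact: (integrable_norm iF).
- move=> n x Dx; rewrite patchE; case: ifPn => // _.
  by rewrite abse0 lee_fin.
Qed.

End ContinuousIntegrals.

(** * Locally uniform series of continuous functions *)

Section LocallyUniformSeries.
Context {R : realType} (c : nat -> R -> R) (P : R -> R).
Local Notation mu := (@lebesgue_measure R).
Hypotheses (c_cont : forall j, continuous (c j))
  (cP : forall A e : R, 0 < e -> exists N, forall n x, (N <= n)%N -> `|x| <= A ->
     `|P x - \sum_(j < n) c j x| <= e).

Lemma partial_sum_continuous n : continuous (fun x => \sum_(j < n) c j x).
Proof.
elim: n => [|n IH].
  rewrite (_ : (fun _ => _) = cst 0); first exact: cst_continuous.
  by apply/funext => x; rewrite big_ord0.
rewrite (_ : (fun _ => _) = (fun x => \sum_(j < n) c j x + c n x)); last first.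
  by apply/funext => x; rewrite big_ord_recr.
by move=> x; apply: cvgD; [exact: IH|exact: c_cont].
Qed.

Lemma locally_uniform_continuous : continuous P.
Proof.
move=> x; apply/cvgrPdist_le => e e0.
have e3 : 0 < e / 3 by rewrite divr_gt0.
(* The ball of radius [|x| + 1] contains all points within 1 of [x], so one partial sum serves for
   [x] and its neighbours. *)
have [N hN] := cP (`|x| + 1) e3.
have /cvgrPdist_le/(_ _ e3) nearS := @partial_sum_continuous N x.
near=> y.
have yx : `|y| <= `|x| + 1.
  rewrite -[y](subrK x) addrC (le_trans (ler_normD _ _))// lerD2l distrC.
  by near: y; exact: (@cvgr_dist_le _ _ _ _ _ id x).
have hx := hN N x (leqnn _) (ler_wpDr ler01 (lexx _)).
have hy := hN N y (leqnn _) yx.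
have hxy : `|\sum_(j < N) c j x - \sum_(j < N) c j y| <= e / 3 by near: y.
move: hx hy hxy; rewrite !ler_norml; lra.
Unshelve. all: by end_near.
Qed.

Lemma cvg_sum_Rintegral (h : R -> R) : continuous h -> (forall x, `|h x| <= 1) ->
  \sum_(j < n) \int[mu]_(x in `[0, 1]) (c j x * h x) @[n --> \oo] -->
  \int[mu]_(x in `[0, 1]) (P x * h x).
Proof.
move=> ch h1.
have cM (F : R -> R) : continuous F -> continuous (fun x => F x * h x).
  by move=> cF x; apply: cvgM; [exact: cF|exact: ch].
have iM (F : R -> R) : continuous F ->
    mu.-integrable `[0, 1] (EFin \o (fun x => F x * h x)).
  by move=> cF; apply: continuous_itv_integrable; exact: cM.
have sumE n : \sum_(j < n) \int[mu]_(x in `[0, 1]) (c j x * h x) =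
    \int[mu]_(x in `[0, 1]) ((\sum_(j < n) c j x) * h x).
  elim: n => [|n IH].
    rewrite big_ord0; under eq_Rintegral do rewrite big_ord0 mul0r.
    by rewrite Rintegral_cst// mul0r.
  rewrite big_ord_recr/= IH -RintegralD//; last 2 first.
  - exact/iM/partial_sum_continuous.
  - exact/iM/c_cont.
  by apply: eq_Rintegral => x _; rewrite big_ord_recr/= mulrDl.
apply/cvgrPdist_le => e e0; have [N hN] := cP 1 e0.
exists N => // n /= Nn; rewrite sumE -RintegralB//; last 2 first.
- exact/iM/locally_uniform_continuous.
- exact/iM/partial_sum_continuous.
have := @Rintegral_near_cst _ (fun x => P x * h x - (\sum_(j < n) c j x) * h x)
  0 1 0 e ltr01.
rewrite mul0r !subr0 mulr1; apply.
  exact: (integrableB _ (iM _ locally_uniform_continuous)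
    (iM _ (@partial_sum_continuous n))).
move=> x /andP[x0 x1]; rewrite subr0 -mulrBl normrM.
rewrite -[leRHS]mulr1 ler_pM// hN// ger0_norm ltW//.
Qed.

End LocallyUniformSeries.

(** * Uniqueness of Fourier coefficients *)

Section TrigonometricMoments.
Context {R : realType}.
Local Notation mu := (@lebesgue_measure R).

Lemma periodicz (f : R -> R) (T : R) : periodic f T ->
  forall (a : R) (z : int), f (a + T * z%:~R) = f a.
Proof.
move=> fT a [n|n].
  by rewrite -[n%:~R]/(n%:R) mulr_natr (periodicn fT).
by rewrite NegzE mulrNz mulrN -(periodicn fT n.+1) -mulr_natr subrK.
Qed.

Lemma cos_periodz (a : R) (z : int) : cos (a + 2 * pi * z%:~R) = cos a.
Proof. by rewrite mulr_natl; exact/periodicz/cosD2pi. Qed.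

Lemma sin_periodz (a : R) (z : int) : sin (a + 2 * pi * z%:~R) = sin a.
Proof. by rewrite mulr_natl; exact/periodicz/sinD2pi. Qed.

Lemma continuous_affine (c a : R) : continuous (fun x : R => x * c + a).
Proof.
by move=> x; apply: cvgD; [apply: cvgM => //|]; exact: cvg_cst.
Qed.

Lemma continuous_cos_affine (c a : R) : continuous (fun x : R => cos (x * c + a)).
Proof.
move=> x; apply: (cvg_comp (fun x => x * c + a) cos).
  exact: continuous_affine.
exact: continuous_cos.
Qed.

(** For nonzero k, the primitive sin(2 pi k x + a) / (2 pi k) takes the same value at 0 and at 1. *)
Lemma Rintegral_cos_affine (k : int) (a : R) :
  \int[mu]_(x in `[0, 1]) cos (x * (2 * pi * k%:~R) + a) =
  if k == 0 then cos a else 0.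
Proof.
case: ifPn => [/eqP ->|k0].
  under eq_Rintegral do rewrite mulr0 mulr0 add0r.
  by rewrite Rintegral_cst//= lebesgue_measure_itv/= lte_fin ltr01/= subr0 mulr1.
set c := 2 * pi * k%:~R.
have c0 : c != 0 by rewrite !mulf_neq0 ?intr_eq0// gt_eqF// pi_gt0.
pose F (x : R) := c^-1 * sin (x * c + a).
have dF x : is_derive x (1 : R) F (cos (x * c + a)).
  have dA : is_derive x (1 : R) (fun x => x * c + a) c.
    rewrite -[X in is_derive _ _ _ X]addr0; apply: is_deriveD.
    by apply: is_derive_eq; rewrite scaler0 add0r; exact: mulr1.
  have -> : cos (x * c + a) = c^-1 *: (cos (x * c + a) * c).
    by rewrite /GRing.scale/= [RHS]mulrC mulfK.
  apply: is_deriveZ; exact: (@is_derive1_comp _ sin).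
have cF : continuous F.
  by move=> x; apply/differentiable_continuous/derivable1_diffP; exact: ex_derive.
rewrite /Rintegral (@continuous_FTC2 _ _ F)//.
- suff -> : F 1 = F 0 by rewrite -EFinB subrr.
  by rewrite /F mul0r mul1r add0r [c + a]addrC sin_periodz.
- exact/continuous_subspaceT/continuous_cos_affine.
- split => [x _| |]; first exact: ex_derive.
  + by apply: cvg_at_right_filter; exact: cF.
  + by apply: cvg_at_left_filter; exact: cF.
- by move=> x _; rewrite derive1E derive_val.
Qed.

Lemma cosM (x y : R) : cos x * cos y = 2^-1 * (cos (x + y) + cos (x - y)).
Proof. by rewrite cosD cosB; field. Qed.

(** The free phase [a] covers cosine and sine coefficients at once, and makes the family of test
    functions stable under multiplication by a shifted cosine. *)
Definition cos_moments_vanish (g : R -> R) := forall (k : int) (a : R),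
  \int[mu]_(x in `[0, 1]) (g x * cos (x * (2 * pi * k%:~R) + a)) = 0.

(** The product-to-sum formula turns the extra cosine into frequencies k + 1 and k - 1 with shifted
    phases, which are again vanishing moments. *)
Lemma cos_moments_vanishM (g : R -> R) (b d : R) : continuous g ->
  cos_moments_vanish g ->
  cos_moments_vanish (fun x => g x * (b + cos (x * (2 * pi) + d))).
Proof.
move=> cg g0 k a.
pose h (k : int) (a : R) x := g x * cos (x * (2 * pi * k%:~R) + a).
have ch l e : mu.-integrable `[0, 1] (EFin \o h l e).
  apply: continuous_itv_integrable => x; apply: cvgM; first exact: cg.
  exact: continuous_cos_affine.
have cZ r l e : mu.-integrable `[0, 1] (EFin \o (fun x => r * h l e x)).
  exact: (integrableZl _ r (ch l e)).
rewrite (_ : Rintegral _ _ _ = \int[mu]_(x in `[0, 1]) (b * h k a x +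
    (2^-1 * h (k + 1) (a + d) x + 2^-1 * h (k - 1) (a - d) x))).
  rewrite RintegralD ?RintegralD ?RintegralZl//; last first.
    exact: (integrableD _ (cZ _ _ _) (cZ _ _ _)).
  by rewrite /h !g0 !mulr0 !addr0.
apply: eq_Rintegral => x _; rewrite /h -mulrA mulrDl [cos _ * cos _]mulrC cosM.
rewrite intrD intrB.
rewrite (_ : x * (2 * pi * (k%:~R + 1)) + (a + d) =
  x * (2 * pi * k%:~R) + a + (x * (2 * pi) + d)); last by ring.
rewrite (_ : x * (2 * pi * (k%:~R - 1)) + (a - d) =
  x * (2 * pi * k%:~R) + a - (x * (2 * pi) + d)); last by ring.
by ring.
Qed.

Lemma bernoulli_le (x : R) n : 0 <= x -> 1 + x *+ n <= (1 + x) ^+ n.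
Proof.
move=> x0; elim: n => [|n IH]; first by rewrite mulr0n addr0 expr0.
rewrite exprS (le_trans _ (ler_wpM2l _ IH)) ?addr_ge0//.
have := mulr_ge0 (mulr_ge0 x0 x0) (ler0n R n).
by rewrite mulrS -mulr_natr; lra.
Qed.

(** The function cos(2 pi s) decreases on [0, 1/2] and is symmetric about 1/2, so reflecting [s] to
    [1 - s] reduces to the monotone half. *)
Lemma cos_le_of_far (d s : R) : 0 < d -> d <= s <= 1 - d ->
  cos (s * (2 * pi)) <= cos (d * (2 * pi)).
Proof.
move=> d0 /andP[ds sd]; have pi0 := pi_gt0 R.
wlog s2 : s ds sd / s <= 2^-1.
  move=> h; have [|/ltW s2] := leP s 2^-1; first exact: h.
  have -> : cos (s * (2 * pi)) = cos ((1 - s) * (2 * pi)).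
    rewrite -[LHS]cosN -[LHS](cos_periodz _ 1); congr cos.
    by ring.
  by apply: h; lra.
by rewrite leNgt ltr_cos ?in_itv/= -?leNgt ?ler_pM2r ?mulr_gt0//;
  apply/andP; split; nra.
Qed.

Lemma cos_le_of_near (d s : R) : 0 <= d <= 2^-1 -> `|s| <= d ->
  cos (d * (2 * pi)) <= cos (s * (2 * pi)).
Proof.
move=> /andP[d0 d2] sd; have pi0 := pi_gt0 R.
rewrite -(cos_norm (s * _)) normrM (gtr0_norm (_ : 0 < 2 * pi)) ?mulr_gt0//.
have s0 := normr_ge0 s.
by rewrite leNgt ltr_cos ?in_itv/= -?leNgt ?ler_pM2r ?mulr_gt0//;
  apply/andP; split; nra.
Qed.

End TrigonometricMoments.

(** * Continuous functions with vanishing or constant-type coefficients *)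

Section FourierUniqueness.
Context {R : realType}.
Local Notation mu := (@lebesgue_measure R).

Lemma Rintegral_ge_cst (g : R -> R) (a b m : R) : a <= b -> continuous g ->
  (forall x, a <= x <= b -> m <= g x) ->
  m * (b - a) <= \int[mu]_(x in `[a, b]) g x.
Proof.
rewrite le_eqVlt => /predU1P[->|ab] cg mg.
  by rewrite subrr mulr0 set_itv1 Rintegral_set1.
rewrite (_ : m * (b - a) = \int[mu]_(x in `[a, b]) m); last first.
  by rewrite Rintegral_cst//= lebesgue_measure_itv/= lte_fin ab.
apply: le_Rintegral => //.
all: by apply: continuous_itv_integrable => //; exact: cst_continuous.
Qed.

(* The trigonometric polynomial [T] below is larger than 1 near [x0] and
   [|T| <= 1] away from [x0], so the integral of [g T^n], which is 0, would be
   unbounded if [g x0 > 0]. *)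
Lemma cos_moments_vanish_le0 (g : R -> R) (x0 : R) : continuous g ->
  cos_moments_vanish g -> 0 < x0 < 1 -> g x0 <= 0.
Proof.
move=> cg g0 /andP[x00 x01]; rewrite leNgt; apply/negP => gx0.
have pi0 := pi_gt0 R.
have [d1 /= d10 hd1] : \forall x \near x0, `|g x0 - g x| <= g x0 / 2.
  by move/cvgrPdist_le: (cg x0); apply; rewrite divr_gt0.
(* Within distance [d] of [x0], [g] stays above [g x0 / 2]. The other two bounds keep this
   neighbourhood in [0, 1] and give |x - x0| <= 1 - d for every x in [0, 1]. *)
pose d := Num.min (d1 / 2) (Num.min x0 (1 - x0)).
have d0 : 0 < d by rewrite !lt_min divr_gt0//= x00 subr_gt0.
have dd1 : d < d1.
  by rewrite (@le_lt_trans _ _ (d1 / 2)) ?ge_min ?lexx//; lra.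
have dx0 : d <= x0 by rewrite !ge_min lexx !orbT.
have dx1 : d <= 1 - x0 by rewrite !ge_min lexx !orbT.
pose q := cos (d * (2 * pi)).
(* The constant makes [T] equal to 1 at distance exactly [d] from [x0]: [T] is at least 1 closer in,
   at least [1 + eta] within [d / 2], and in [-1, 1] farther away. *)
pose T (x : R) := (1 - q) + cos (x * (2 * pi) + (- x0 * (2 * pi))).
have TE x : T x = 1 - q + cos ((x - x0) * (2 * pi)) by rewrite /T -mulrDl.
pose eta := cos (d / 2 * (2 * pi)) - q.
have eta0 : 0 < eta.
  rewrite subr_gt0 /q ltr_cos ?in_itv/=; first by rewrite ltr_pM2r ?mulr_gt0//; lra.
  - by apply/andP; split; nra.
  - by apply/andP; split; nra.
have cT : continuous T.
  by move=> x; apply: cvgD; [exact: cvg_cst|exact: continuous_cos_affine].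
have gT : forall n, continuous (fun x => g x * T x ^+ n) /\
    cos_moments_vanish (fun x => g x * T x ^+ n).
  elim=> [|n [IHc IH]].
    by rewrite (_ : (fun _ => _) = g)//; apply/funext => x; rewrite expr0 mulr1.
  rewrite (_ : (fun _ => _) = (fun x => g x * T x ^+ n * T x)); last first.
    by apply/funext => x; rewrite exprSr mulrA.
  split; last exact: cos_moments_vanishM.
  by move=> x; apply: cvgM; [exact: IHc|exact: cT].
have [|xm _ gM] := @EVT_max R (fun x => `|g x|) 0 1 ler01.
  by apply: continuous_subspaceT => x; apply: cvg_norm; exact: cg.
pose G := `|g xm|.
have lower n x : 0 <= x <= 1 -> - G <= g x * T x ^+ n.
  move=> x01'; have gG : `|g x| <= G by apply: gM; rewrite in_itv.
  have [near_x0|far] := leP `|x - x0| d.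
    rewrite (@le_trans _ _ 0)//; first by rewrite oppr_le0 normr_ge0.
    rewrite mulr_ge0//.
      have := hd1 x; rewrite /= distrC => /(_ (le_lt_trans near_x0 dd1)).
      by rewrite ler_norml; lra.
    rewrite exprn_ge0// TE.
    suff : q <= cos ((x - x0) * (2 * pi)) by lra.
    by apply: cos_le_of_near => //; apply/andP; split; lra.
  suff T1 : `|T x| <= 1.
    have : `|g x * T x ^+ n| <= G.
      rewrite normrM -[leRHS]mulr1 ler_pM// normrX exprn_ile1//.
    by rewrite ler_norml => /andP[].
  have : cos ((x - x0) * (2 * pi)) <= q.
    rewrite -cos_norm normrM (gtr0_norm (_ : 0 < 2 * pi)) ?mulr_gt0//.
    apply: cos_le_of_far => //; rewrite ltW//= ler_norml.
    by case/andP: x01' => *; apply/andP; split; lra.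
  have := cos_geN1 ((x - x0) * (2 * pi)); have := cos_le1 (d * (2 * pi)).
  by rewrite -/q TE ler_norml; lra.
have peak n x : x0 - d / 2 <= x <= x0 + d / 2 ->
    g x0 / 2 * (1 + eta) ^+ n <= g x * T x ^+ n.
  move=> /andP[xl xr]; have near_x0 : `|x - x0| <= d / 2.
    by rewrite ler_norml; apply/andP; split; lra.
  rewrite ler_pM//.
  - by rewrite divr_ge0// ltW.
  - by rewrite exprn_ge0// addr_ge0// ltW.
  - have := hd1 x; rewrite /= distrC => h.
    by have := h ltac:(lra); rewrite ler_norml; lra.
  - have T1 : 1 + eta <= T x.
      suff : cos (d / 2 * (2 * pi)) <= cos ((x - x0) * (2 * pi)).
        by rewrite TE /eta; lra.
      by apply: cos_le_of_near => //; apply/andP; split; lra.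
    by apply: lerXn2r => //; rewrite nnegrE; lra.
(* The moment with frequency and phase 0 is the plain integral of g T^n. Split at x0 - d/2 and x0 +
   d/2: the outer pieces have total length at most 1, so they contribute at least [- G], which the
   central piece cannot exceed in size. *)
have all_n n : g x0 / 2 * (1 + eta) ^+ n * d <= G.
  have := (gT n).2 0 0.
  under eq_Rintegral do rewrite mulr0 mulr0 addr0 cos0 mulr1.
  have e1 : 0 <= x0 - d / 2 by lra.
  have e2 : x0 - d / 2 <= x0 + d / 2 by lra.
  have e3 : x0 + d / 2 <= 1 by lra.
  have cF := (gT n).1.
  rewrite (Rintegral_itvD e1 (le_trans e2 e3) cF) (Rintegral_itvD e2 e3 cF).
  have low a b : 0 <= a -> b <= 1 -> forall x, a <= x <= b ->
      - G <= g x * T x ^+ n.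
    move=> a0 b1 x /andP[ax xb]; apply: lower.
    by rewrite (le_trans a0 ax) (le_trans xb b1).
  have h1 := Rintegral_ge_cst e1 cF (low _ _ (lexx _) (le_trans e2 e3)).
  have h2 := Rintegral_ge_cst e2 cF (peak n).
  have h3 := Rintegral_ge_cst e3 cF (low _ _ (le_trans e1 e2) (lexx _)).
  move: h2; rewrite (_ : x0 + d / 2 - (x0 - d / 2) = d); last by lra.
  have : 0 <= G by exact: normr_ge0.
  move: h1 h3; move: (Rintegral _ _ _) (Rintegral _ _ _) (Rintegral _ _ _).
  move: (_ * d) => z I1 I2 I3; nra.
(* By Bernoulli's inequality the left side of [all_n] is at least [n%:R * b], which exceeds [G] for
   large n. *)
pose b := g x0 / 2 * d * eta.
have b0 : 0 < b by rewrite !mulr_gt0// invr_gt0.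
have [n hn] : exists n, G / b < n%:R.
  by exists (Num.truncn (G / b)).+1; exact: truncnS_gt.
have := all_n n; apply/negP; rewrite -ltNge.
move: hn; rewrite ltr_pdivrMr// => hn; apply: (lt_le_trans hn).
have hB := bernoulli_le n (ltW eta0); rewrite -(mulr_natr eta) in hB.
have -> : n%:R * b = g x0 / 2 * d * (eta * n%:R) by rewrite /b; ring.
rewrite [leRHS]mulrAC ler_pM2l ?mulr_gt0 ?invr_gt0//.
by rewrite (le_trans _ hB)// lerDr.
Qed.

Lemma cos_moments_unique (g : R -> R) (x0 : R) : continuous g ->
  cos_moments_vanish g -> 0 < x0 < 1 -> g x0 = 0.
Proof.
move=> cg g0 x01; apply/eqP; rewrite eq_le cos_moments_vanish_le0//=.
rewrite -oppr_le0; apply: (@cos_moments_vanish_le0 (fun x => - g x)) => //.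
  by move=> x; apply: cvgN; exact: cg.
move=> k a; under eq_Rintegral do rewrite mulNr -mulN1r.
rewrite RintegralZl ?g0 ?mulr0//.
apply: continuous_itv_integrable => x; apply: cvgM; first exact: cg.
exact: continuous_cos_affine.
Qed.

(** For the converse, the addition formula expresses the moments of P - c at any phase through the
    given cosine and sine integrals, so they all vanish and P = c on (0, 1). *)
Lemma fourier_constP (P : R -> R) (c : R) : continuous P ->
  (forall x, 0 <= x < 1 -> P x = c) <->
  (forall k : int,
    \int[mu]_(x in `[0, 1]) (P x * cos (- (x * (2 * pi * k%:~R)))) =
      (if k == 0 then c else 0) /\
    \int[mu]_(x in `[0, 1]) (P x * sin (- (x * (2 * pi * k%:~R)))) = 0).
Proof.
move=> cP.
have sinE (x : R) k : sin (- (x * (2 * pi * k%:~R))) =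
    cos (x * (2 * pi * k%:~R) + pi / 2) by rewrite cosDpihalf sinN.
have ic (g : R -> R) (k : int) a : continuous g -> mu.-integrable `[0, 1]
    (EFin \o (fun x => g x * cos (x * (2 * pi * k%:~R) + a))).
  move=> cg; apply: continuous_itv_integrable => x; apply: cvgM; first exact: cg.
  exact: continuous_cos_affine.
have cc : continuous (cst c : R -> R) by exact: cst_continuous.
split=> [Pc k|Pk].
  have PcE a : \int[mu]_(x in `[0, 1]) (P x * cos (x * (2 * pi * k%:~R) + a)) =
      c * if k == 0 then cos a else 0.
    have sub : `[0, 1[ `<=` (`[0, 1] : set R) by exact: subset_itv_co_cc.
    rewrite -Rintegral_cos_affine -RintegralZl//; last first.
      by apply: continuous_itv_integrable; exact: continuous_cos_affine.
    rewrite -!Rintegral_itv_bndo_bndc.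
    - by apply: eq_Rintegral => x; rewrite inE/= in_itv/= => /Pc ->.
    - by apply: (@integrableS _ _ _ mu `[0, 1]%classic) => //; exact: (ic (cst c)).
    - by apply: (@integrableS _ _ _ mu `[0, 1]%classic) => //; exact: ic.
  split.
    under eq_Rintegral do rewrite cosN -[_ * (_ * k%:~R)]addr0.
    by rewrite PcE cos0; case: ifP; rewrite ?mulr1 ?mulr0.
  under eq_Rintegral do rewrite sinE.
  by rewrite PcE cos_pihalf if_same mulr0.
have open01 x : 0 < x < 1 -> P x = c.
  move=> x01; apply/eqP; rewrite -subr_eq0; apply/eqP.
  apply: (@cos_moments_unique (fun x => P x - c)) => //.
    by move=> y; apply: cvgB; [exact: cP|exact: cvg_cst].
  move=> k a; under eq_Rintegral do rewrite mulrBl.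
  rewrite RintegralB//; last 2 first.
  - exact: ic.
  - exact: (ic (cst c)).
  rewrite RintegralZl ?Rintegral_cos_affine//; last first.
    by apply: continuous_itv_integrable; exact: continuous_cos_affine.
  have [Pcos Psin] := Pk k.
  have iP h : mu.-integrable `[0, 1] (EFin \o (fun x => P x * h x)) ->
    forall r, mu.-integrable `[0, 1] (EFin \o (fun x => r * (P x * h x))).
    by move=> i r; exact: (integrableZl _ r i).
  have icos : mu.-integrable `[0, 1]
      (EFin \o (fun x => P x * cos (- (x * (2 * pi * k%:~R))))).
    have := ic P k 0 cP; congr (mu.-integrable _ _).
    by apply/funext => y /=; rewrite addr0 cosN.
  have isin : mu.-integrable `[0, 1]
      (EFin \o (fun x => P x * sin (- (x * (2 * pi * k%:~R))))).
    have := ic P k (pi / 2) cP; congr (mu.-integrable _ _).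
    by apply/funext => y /=; rewrite sinE.
  rewrite (_ : Rintegral _ _ _ = \int[mu]_(y in `[0, 1])
    (cos a * (P y * cos (- (y * (2 * pi * k%:~R)))) +
     sin a * (P y * sin (- (y * (2 * pi * k%:~R)))))); last first.
    by apply: eq_Rintegral => y _; rewrite cosD cosN sinN; ring.
  rewrite RintegralD ?RintegralZl ?Pcos ?Psin//; try exact: iP.
  by case: ifP => _; ring.
move=> x /andP[]; rewrite le_eqVlt => /predU1P[<- _|x0 x1]; last first.
  by apply: open01; rewrite x0.
(* [P] is continuous at the left end point. *)
apply/eqP; rewrite eq_sym -subr_eq0 -normr_le0; apply/ler_addgt0Pr => e e0.
have /cvgrPdist_le/(_ e e0)[d /= d0 hd] := cP 0.
pose y := Num.min (d / 2) 2^-1.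
have y0 : 0 < y by rewrite lt_min divr_gt0//= invr_gt0.
have yd : y < d by rewrite (@le_lt_trans _ _ (d / 2)) ?ge_min ?lexx//; lra.
have y1 : y < 1 by rewrite (@le_lt_trans _ _ 2^-1) ?ge_min ?lexx ?orbT//; lra.
rewrite add0r -(open01 y) ?y0// distrC; apply: hd => /=.
by rewrite sub0r normrN gtr0_norm.
Qed.

End FourierUniqueness.

(** * Folding a half-line *)

Section HalfLine.
Context {R : realType} (chi : R -> R).
Local Notation mu := (@lebesgue_measure R).
Hypotheses (chi_kernel : is_kernel chi) (chi_cont : continuous chi).

(** On [0, 1) the conditions [x < k] and [k < x] are replaced by a fixed set [K] of indices, so that
    the sum becomes a continuous function of [x] on the whole line. *)
Let restr (K : int -> bool) (x : R) (k : int) :=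
  if K k then chi (x - k%:~R) else 0.

Lemma zsum_to_finite (a : int -> R) m n :
  (forall j, (m <= j)%N -> a (Negz j) = 0) ->
  (forall j, (n <= j)%N -> a (Posz j) = 0) -> zsum_to a (zpartial a (m, n)).
Proof.
move=> am an; apply/zsum_toP => e e0; exists (maxn m n) => m' n'.
rewrite !geq_max => /andP[mm' _] /andP[_ nn'].
have tail (b : nat -> R) p p' : (p <= p')%N ->
    (forall j, (p <= j)%N -> b j = 0) -> \sum_(j < p') b j = \sum_(j < p) b j.
  move=> pp' b0; rewrite -!(big_mkord predT b) (big_cat_nat (n := p))//=.
  by rewrite [X in _ + X]big_nat [X in _ + X]big1 ?addr0// => i /andP[/b0].
rewrite /zpartial/= (tail (fun j => a (Negz j)) _ _ mm' am).
by rewrite (tail (fun j => a (Posz j)) _ _ nn' an) subrr normr0 ltW.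
Qed.

Lemma restr_to K x : zsum_to (restr K x) (zsum (restr K x)).
Proof.
have [beta [M [_ _ chiM _]]] := kernel_bounds chi_kernel.
apply: (@zbounded_cvg _ _ M) => p; apply: le_trans (chiM x p).
by apply: ler_zpartial => k; rewrite /restr; case: ifP; rewrite ?normr0.
Qed.

(** Indices in [K] are at distance at least [r] from every point of [-A, A], so the moment bound
    makes their sum small uniformly in [x]. *)
Lemma restr_tail (A e : R) : 0 < e -> exists2 r : R, 0 <= r &
  forall (K : int -> bool) x, `|x| <= A -> (forall k, K k -> A + r <= `|k%:~R|) -> `|zsum (restr K x)| <= e.
Proof.
move=> e0; have [beta [M [beta0 M0 _ chiM]]] := kernel_bounds chi_kernel.
pose r := ((M + 1) / e) `^ beta^-1.
have Me0 : 0 < (M + 1) / e by rewrite divr_gt0// ltr_wpDl.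
have r0 : 0 <= r by exact: powR_ge0.
have rE : r `^ beta = (M + 1) / e.
  by rewrite /r -powRrM mulVf ?gt_eqF// powRr1// ltW.
exists r => // K x xA Kr; apply: zbounded_norm => p.
apply: (@le_trans _ _ (zpartial (fun k => (e / (M + 1)) *
    (`|chi (x - k%:~R)| * `|x - k%:~R| `^ beta)) p)); last first.
  have M1 : 0 < M + 1 by rewrite ltr_wpDl.
  rewrite zpartialZ mulrAC ler_pdivrMr// ler_pM2l//.
  by rewrite (le_trans (chiM _ _))// lerDl.
apply: ler_zpartial => k; rewrite /restr; case: ifPn => [Kk|_]; last first.
  by rewrite normr0 !mulr_ge0 ?powR_ge0 ?invr_ge0 ?addr_ge0// ltW.
have far : r <= `|x - k%:~R|.
  rewrite distrC (le_trans _ (lerB_dist _ _))//.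
  by have := Kr k Kk; lra.
rewrite mulrCA ler_peMr// -[e / _]invf_div -rE mulrC ler_pdivlMr ?rE//.
by rewrite mul1r -rE ge0_ler_powR ?nnegrE ?(ltW beta0).
Qed.

(* [pos] enumerates the integers selected by [K], [Kn n] selects the first [n]
   of them, and [D] is tiled by the unit intervals [[- pos j, 1 - pos j]]. *)
Variables (D : set R) (A : (set R)^nat) (K : int -> bool) (Kn : nat -> int -> bool)
  (pos : nat -> int).
Hypotheses (mD : measurable D) (mA : forall n, measurable (A n))
  (AD : forall n, A n `<=` D)
  (nearA : forall x, D x -> \forall n \near \oo, A n x)
  (AE : forall n (F : R -> R), continuous F -> \sum_(j < n)
     \int[mu]_(x in `[- (pos j)%:~R, 1 - (pos j)%:~R]) F x =
     \int[mu]_(x in A n) F x)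
  (KnK : forall n k, Kn n k -> K k)
  (Kfar : forall n k, K k -> ~~ Kn n k -> n%:R <= `|k%:~R| :> R)
  (KnE : forall n x, (0 < n)%N ->
     zsum_to (restr (Kn n) x) (\sum_(j < n) chi (x - (pos j)%:~R))).

Let P (x : R) := zsum (restr K x).

Lemma restr_locally_uniform (B e : R) : 0 < e -> exists N, forall n x,
  (N <= n)%N -> `|x| <= B -> `|P x - \sum_(j < n) chi (x - (pos j)%:~R)| <= e.
Proof.
move=> e0; have [r r0 tail] := restr_tail B e0.
(* The terms left after [n] of them have |k| >= n, and this threshold ensures n >= B + r, as the
   tail estimate requires. *)
exists (Num.truncn (B + r)).+1 => n x Nn xB.
have n0 : (0 < n)%N by exact: leq_trans Nn.
rewrite -mulN1r -(zsum_to_zsum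
  (zsum_toD (@restr_to K x) (zsum_toZ (c := -1) (@KnE n x n0)))).
rewrite (_ : (fun k => _) = restr (fun k => K k && ~~ Kn n k) x).
  apply: tail => // k /andP[Kk Knk]; apply: le_trans (Kfar Kk Knk).
  by rewrite ltW// (lt_le_trans (truncnS_gt _))// ler_nat.
apply/funext => k; rewrite /restr; have := @KnK n k.
case: (Kn n k) => [->//|_]; first by rewrite mulN1r subrr.
by rewrite mulr0 addr0 andbT.
Qed.

Let c_cont j : continuous (fun x : R => chi (x - (pos j)%:~R)).
Proof.
move=> x; apply: (cvg_comp (fun x : R => x - (pos j)%:~R) chi); last exact: chi_cont.
by apply: cvgB => //; exact: cvg_cst.
Qed.

(** Translating the j-th tile onto [0, 1] turns [chi] into its shift by [pos j] and leaves the
    periodic [h] unchanged. The integral over [A n] is thus the n-th partial sum of a series whose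
    limit is computed in two ways. *)
Lemma half_line_fold (h : R -> R) : continuous h -> (forall x, `|h x| <= 1) ->
  (forall x (z : int), h (x + z%:~R) = h x) ->
  \int[mu]_(x in D) (chi x * h x) = \int[mu]_(x in `[0, 1]) (P x * h x).
Proof.
move=> ch h1 hz.
have cF : continuous (fun x => chi x * h x).
  by move=> x; apply: cvgM; [exact: chi_cont|exact: ch].
have iF : mu.-integrable D (EFin \o (fun x => chi x * h x)).
  have [[ichi _] _ _] := chi_kernel.
  apply: (@integrableS _ _ _ mu setT) => //.
  apply: (le_integrable _ _ _ ichi) => //.
    by apply/measurable_EFinP; exact: continuous_measurable_fun.
  by move=> x _; rewrite /= lee_fin normrM ler_piMr.
have lim1 := @cvg_Rintegral_sets _ D A _ mD mA AD nearA iF.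
have lim2 := cvg_sum_Rintegral c_cont restr_locally_uniform ch h1.
apply/esym/(cvg_unique _ lim2) => //; apply: cvg_trans lim1.
apply: near_eq_cvg; apply: nearW => n; rewrite -AE//; apply: eq_bigr => j _.
have := @Rintegral_itv_shift _ _ 0 1 (- (pos j)%:~R) ler01 cF.
rewrite add0r => <-; apply: eq_Rintegral => x _.
by rewrite -mulrNz hz.
Qed.

Lemma half_line_fourierP (c : R) :
  (forall x, 0 <= x < 1 -> P x = c) <->
  (forall k : int, fourier_on D chi k = if k == 0 then c%:C else 0).
Proof.
have cP : continuous P := locally_uniform_continuous c_cont restr_locally_uniform.
rewrite (fourier_constP c cP).
suff coef k : fourier_on D chi k =
    (\int[mu]_(x in `[0, 1]) (P x * cos (- (x * (2 * pi * k%:~R))))) +i*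
    (\int[mu]_(x in `[0, 1]) (P x * sin (- (x * (2 * pi * k%:~R))))).
  split=> h k; have := h k; rewrite coef.
    by move=> [-> ->]; case: ifP.
  by case: ifP => _ [].
(* At an integer frequency, an integer translation changes the angle by a multiple of 2 pi. *)
have arg (x : R) (z : int) : - ((x + z%:~R) * (2 * pi * k%:~R)) =
    - (x * (2 * pi * k%:~R)) + 2 * pi * (- (z * k))%:~R.
  by rewrite mulrNz intrM; ring.
have carg : continuous (fun x : R => - (x * (2 * pi * k%:~R))).
  move=> x; apply: cvgN; apply: cvgM => //; exact: cvg_cst.
rewrite -!half_line_fold.
- congr (_ +i* _); apply: eq_Rintegral => u _ /=.
    by rewrite mul0r subr0.
  by rewrite mul0r addr0.
- by move=> x; apply: (cvg_comp _ sin); [exact: carg|exact: continuous_sin].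
- by move=> x; exact: sin_max.
- by move=> x z; rewrite arg sin_periodz.
- by move=> x; apply: (cvg_comp _ cos); [exact: carg|exact: continuous_cos].
- by move=> x; exact: cos_max.
- by move=> x z; rewrite arg cos_periodz.
Qed.

End HalfLine.

(** * Half-line Fourier integrals of the kernel *)

Section FourierOfKernel.
Context {R : realType} (chi : R -> R).
Hypotheses (chi_kernel : is_kernel chi) (chi_cont : continuous chi)
  (chi_zero : forall x : R, 0 <= x < 1 -> chi x = 0).
Local Notation mu := (@lebesgue_measure R).

Lemma Psi_minus_fourierP (c : R) :
  (forall x, 0 <= x < 1 -> Psi_minus chi x = c) <->
  (forall k : int, fourier_on `]-oo, 0] chi k = if k == 0 then c%:C else 0).
Proof.
pose K (k : int) := 0 < k.
pose Kn (n : nat) (k : int) := (0 < k) && (k <= n%:Z).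
have PsiE x : 0 <= x < 1 ->
    Psi_minus chi x = zsum (fun k => if K k then chi (x - k%:~R) else 0).
  move=> /andP[x0 x1]; congr zsum; apply/funext => k; rewrite /K.
  rewrite (_ : (x < k%:~R) = (0 < k))//; apply/idP/idP => [xk|k0].
    by rewrite -(ltr0z R) (le_lt_trans x0).
  by rewrite (lt_le_trans x1)// -[leLHS]/(1%:~R) ler_int.
rewrite -(@half_line_fourierP _ chi chi_kernel chi_cont `]-oo, 0]%classic
  (fun n => `[- n%:R, 0]%classic) K Kn (fun j => Posz j.+1)) //.
- by split=> h x x01; have := h x x01; rewrite PsiE.
- by move=> n; apply: subset_itvr; rewrite bnd_simp.
- move=> x; rewrite /= in_itv/= => x0; exists (Num.truncn (- x)).+1 => // n /= xn.
  rewrite in_itv/= x0 andbT lerNl ltW// (lt_le_trans (truncnS_gt _))//.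
  by rewrite ler_nat.
- move=> n F cF; have negn : {homo (fun j : nat => - j%:R : R) :
      i j / (i <= j)%N >-> j <= i} by move=> i j ij; rewrite lerN2 ler_nat.
  have := sum_Rintegral_itvN n negn cF; rewrite oppr0 => <-.
  apply: eq_bigr => j _; congr (Rintegral _ _ _).
  rewrite (_ : 1 - _ = - j%:R :> R)//.
  by rewrite -[(Posz j.+1)%:~R]/(j.+1%:R) -natr1; ring.
- by move=> n k /andP[].
- move=> n k Kk; rewrite /Kn -/(K k) Kk/= -ltNge => nk.
  rewrite ger0_norm; last by rewrite ler0z ltW.
  by rewrite -[n%:R]/(n%:~R) ler_int ltW.
- move=> n x n0; set a := fun k => _.
  (* The nonnegative range starts at index 0, which is not selected, so [n + 1] of its terms are
     needed to reach index n. *)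
  have -> : \sum_(j < n) chi (x - (Posz j.+1)%:~R) = zpartial a (0%N, n.+1).
    rewrite /zpartial/= big_ord0 add0r big_ord_recl/= {1}/a /Kn/= add0r.
    apply: eq_bigr => j _; rewrite /a ifT//.
    by have := ltn_ord j; rewrite /Kn /bump; lia.
  apply: zsum_to_finite => j // nj.
  by rewrite /a /Kn lez_nat leqNgt nj andbF.
Qed.

Lemma Psi_plus_fourierP (c : R) :
  (forall x, 0 <= x < 1 -> Psi_plus chi x = c) <->
  (forall k : int, fourier_on `[0, +oo[ chi k = if k == 0 then c%:C else 0).
Proof.
(* Including index 0 supplies the tile [0, 1] of the half-line; its term [chi x] is 0 for [x] in [0,
   1), so the sum is still [Psi_plus] there. *)
pose K (k : int) := k <= 0.
pose Kn (n : nat) (k : int) := (k <= 0) && (- n%:Z < k).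
have PsiE x : 0 <= x < 1 ->
    Psi_plus chi x = zsum (fun k => if K k then chi (x - k%:~R) else 0).
  move=> /andP[x0 x1]; congr zsum; apply/funext => k; rewrite /K.
  have [k0|k0|->] := ltgtP k 0.
  - by rewrite (lt_le_trans _ x0)// ltrz0.
  - by rewrite ltNge ltW// (lt_le_trans x1)// -[leLHS]/(1%:~R) ler_int.
  - by rewrite subr0 chi_zero ?x0// if_same.
rewrite -(@half_line_fourierP _ chi chi_kernel chi_cont `[0, +oo[%classic
  (fun n => `[0, n%:R]%classic) K Kn (fun j => - Posz j)) //.
- by split=> h x x01; have := h x x01; rewrite PsiE.
- by move=> n; apply: subset_itvl; rewrite bnd_simp.
- move=> x; rewrite /= in_itv/= andbT => x0; exists (Num.truncn x).+1 => // n /= xn.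
  by rewrite in_itv/= x0/= ltW// (lt_le_trans (truncnS_gt _))// ler_nat.
- move=> n F cF; rewrite -(@sum_Rintegral_itv _ F (fun j => j%:R))//.
    apply: eq_bigr => j _; congr (Rintegral _ _ _).
    by rewrite mulrNz opprK addrC natr1.
  by move=> i j ij; rewrite ler_nat.
- by move=> n k /andP[].
- move=> n k Kk; rewrite /Kn -/(K k) Kk/= -leNgt => nk.
  by rewrite ler0_norm ?lerz0// -mulrNz -[n%:R]/(n%:~R) ler_int lerNr.
- move=> [//|n] x _; set a := fun k => _.
  (* Of the indices 0, -1, ..., -n, only 0 belongs to the nonnegative range. *)
  have -> : \sum_(j < n.+1) chi (x - (- Posz j)%:~R) = zpartial a (n, 1%N).
    rewrite /zpartial/= big_ord_recl big_ord1 addrC/=; congr (_ + _).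
    apply: eq_bigr => j _; rewrite /a NegzE ifT//.
    by have := ltn_ord j; rewrite /Kn; lia.
  apply: zsum_to_finite => j nj.
    by rewrite /a /Kn NegzE ltrN2 ltz_nat ltnS ltnNge nj andbF.
  by case: j nj.
Qed.

End FourierOfKernel.

(** * Equivalence of the limit, the Psi conditions and the Fourier conditions *)

Theorem theorem2p11 (R : realType) (f : R -> R) (t alpha : R) (chi : R -> R)
    (f_bounded : [bounded f x | x in [set: R]])
    (f_loc : locally_integrable [set: R] f)
    (f_jump : jump_discontinuity f t)
    (chi_kernel : is_kernel chi)
    (chi_zero : forall x : R, 0 <= x < 1 -> chi x = 0) :
  let i := kantorovich chi w f t @[w --> +oo] -->
             alpha * right_lim f t + (1 - alpha) * left_lim f t in
  let ii := forall x : R, 0 <= x < 1 -> Psi_minus chi x = alpha in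
  let iii := forall x : R, 0 <= x < 1 -> Psi_plus chi x = 1 - alpha in
  let iv := forall k : int, fourier_on `]-oo, 0] chi k =
              if k == 0 then alpha%:C else 0 in
  let v := forall k : int, fourier_on `[0, +oo[ chi k =
             if k == 0 then (1 - alpha)%:C else 0 in
  [/\ ii -> i,
      t != 0 -> i -> ii,
      ii <-> iii
    & continuous chi -> (ii <-> iv) /\ (ii <-> v)].
Proof.
move=> i ii iii iv v.
have [f_right f_left f_neq] := f_jump.
have chi0 : chi 0 = 0 by rewrite chi_zero// lexx ltr01.
have PsiD x : Psi_plus chi x = 1 - Psi_minus chi x.
  by rewrite -(Psi_minusD_plus chi_kernel x chi0) addrAC subrr add0r.
have asymptotic := kantorovich_asymptotic f_bounded f_loc f_right f_left
  chi_kernel chi_zero.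
have ii_iii : ii <-> iii.
  split=> h x x01; first by rewrite PsiD h.
  by have := h x x01; rewrite PsiD; lra.
split => //.
- move=> ii_holds; apply/cvgrPdist_le => e /asymptotic; apply: filterS => w.
  (* Periodicity replaces [w * t] by its fractional part, which lies in [0, 1). *)
  have minusE : Psi_minus chi (w * t) = alpha.
    rewrite -(subrK (Num.floor (w * t))%:~R (w * t)) Psi_minusDz// ii_holds//.
    have /andP[] := floor_itv (w * t); rewrite intrD => lb ub.
    by apply/andP; split; lra.
  rewrite PsiD minusE distrC => h; apply: le_trans h.
  by rewrite [alpha * _]mulrC [(1 - alpha) * _]mulrC.
- move=> t0 i_holds x x01; apply/eqP/negPn/negP => /eqP PsiN.
  (* This is the gap between the prescribed limit and the main term of the asymptotics whenever
     [w * t] is congruent to [x] modulo 1. *)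
  pose e := `|(right_lim f t - left_lim f t) * (Psi_minus chi x - alpha)|.
  have e0 : 0 < e by rewrite normr_gt0 mulf_neq0// subr_eq0; exact/eqP.
  have e3 : 0 < e / 3 by rewrite divr_gt0.
  have near_i : \forall w \near +oo, `|alpha * right_lim f t +
      (1 - alpha) * left_lim f t - kantorovich chi w f t| <= e / 3.
    by move/cvgrPdist_le: i_holds; apply.
  have [W [_ hW]] := filterI (asymptotic _ e3) near_i.
  have [w Ww wE] : exists2 w, W < w & Psi_minus chi (w * t) = Psi_minus chi x.
    (* Dividing x + m by [t], with m of the sign of [t] and large, gives a [w] beyond [W]. The extra
       1 compensates for [x < 1] when [t] is negative. *)
    pose n := (Num.truncn (`|W| * `|t| + 1)).+1.
    have nW : `|W| * `|t| + 1 < n%:R by exact: truncnS_gt.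
    pose m : int := if 0 < t then n%:Z else - n%:Z.
    exists ((x + m%:~R) / t); last by rewrite divfK// Psi_minusDz.
    rewrite (le_lt_trans (ler_norm W))// /m.
    case/andP: x01 => x0 x1; have [tgt0|tle0] := ltP 0 t.
      rewrite ltr_pdivlMr//; move: nW; rewrite (gtr0_norm tgt0).
      by rewrite -[n%:~R]/(n%:R); lra.
    have tlt0 : t < 0 by rewrite lt_neqAle t0.
    rewrite ltr_ndivlMr//; move: nW; rewrite (ltr0_norm tlt0) mulrNz.
    by rewrite -[n%:~R]/(n%:R); lra.
  have [h1 h2] := hW w Ww; move: h1; rewrite PsiD !wE => h1.
  (* At this [w] the operator is within [e / 3] of two values that are [e] apart. *)
  suff : e <= e / 3 + e / 3 by lra.
  apply: le_trans (lerD h1 h2); rewrite addrC; apply: le_trans (ler_normD _ _).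
  rewrite /e le_eqVlt; apply/orP; left; rewrite -normrN; apply/eqP.
  by congr (`|_|); ring.
move=> chi_cont; split; first exact: Psi_minus_fourierP.
rewrite ii_iii; exact: Psi_plus_fourierP.
Qed.
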